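(* Let $a_{n,k,r}$ denote the number of run-sorted permutations of $[n]$ having $k$ runs and $r$ right-to-left minima, with $a_{0,0,0}=1$ and $a_{1,1,1}=1$. Then for all $n\ge2$ and $k,r\ge1$, $$a_{n,k,r}=a_{n-1,k,r-1}+(k-1)\,a_{n-1,k,r}+(n-2)\,a_{n-2,k-1,r-1}.$$
   Context: A run of a permutation is a maximal increasing factor of consecutive letters. A permutation of $[m]$ is run-sorted if it is the concatenation of the blocks of a set partition of $[m]$ in block representation (elements increasing in each block, blocks ordered by increasing minima); equivalently the minima of its successive runs are increasing. A right-to-left minimum of $\pi=\pi_1\cdots\pi_m$ is an entry $\pi_i$ with $\pi_i<\pi_j$ for all $j>i$. The numbers $a_{m,k,r}$ are $0$ whenever no such permutation exists (in particular for $k=0$ or $r=0$ when $m\ge1$). *)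

(* Defs.v *)
From mathcomp Require Import all_boot all_fingroup.

Set Implicit Arguments.
Unset Strict Implicit.
Unset Printing Implicit Defensive.

(* A permutation of [n] is an element s of 'S_n: both positions and letters
   range over 'I_n = {0, ..., n-1} instead of {1, ..., n}. *)

Section RunSorted.

Variable n : nat.
Implicit Types (s : 'S_n) (B : {set 'I_n}) (P : {set {set 'I_n}}).

Definition one_line s : seq 'I_n := [seq s i | i <- enum 'I_n].

(* n is only the value on the empty set, which is never a block. *)
Definition block_min B : nat := \big[minn/n]_(x in B) x.

(* [enum B] lists the elements of B in increasing order. *)
Definition block_representation P : seq (seq 'I_n) :=
  [seq enum B | B : {set 'I_n} <-
     sort (fun B C : {set 'I_n} => block_min B <= block_min C) (enum P)].

Definition run_sorted s : bool :=
  [exists P : {set {set 'I_n}},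
     partition P [set: 'I_n] &&
     (one_line s == flatten (block_representation P))].

(* A nonempty factor s_i ... s_j is encoded by its end positions i <= j. *)
Definition increasing_factor s (f : 'I_n * 'I_n) : bool :=
  (f.1 <= f.2) &&
  [forall p : 'I_n, forall q : 'I_n,
     [&& f.1 <= p, p < q & q <= f.2] ==> (s p < s q)].

Definition is_run s (f : 'I_n * 'I_n) : bool :=
  increasing_factor s f &&
  [forall g : 'I_n * 'I_n,
     [&& increasing_factor s g, g.1 <= f.1 & f.2 <= g.2] ==> (g == f)].

Definition num_runs s : nat := #|[set f | is_run s f]|.

Definition is_rlmin s (i : 'I_n) : bool :=
  [forall j : 'I_n, (i < j) ==> (s i < s j)].

Definition num_rlmin s : nat := #|[set i | is_rlmin s i]|.

End RunSorted.

Definition run_sorted_count (n k r : nat) : nat :=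
  #|[set s : 'S_n | [&& run_sorted s, num_runs s == k & num_rlmin s == r]]|.

(* Main.v *)
Require Import Defs.
From mathcomp Require Import all_boot all_fingroup.
From mathcomp Require Import zify.

(** A permutation is run-sorted exactly when the first letter of each run is a
    right-to-left minimum.  Insert the largest letter into a run-sorted
    permutation of length n-1: at the end it creates one right-to-left minimum;
    at the end of one of the other k-1 runs it changes neither statistic; inside
    a run, just before y, it splits the run, and the result is run-sorted iff y
    is a right-to-left minimum.  The permutations carrying such a marked y, a
    right-to-left minimum that does not start a run, are counted by y: deleting
    y and standardizing loses one right-to-left minimum and no run, and y goes
    back in a unique place, right after the last smaller letter.  So each of the
    n-2 values of y other than the smallest letter contributes
    a_{n-2,k-1,r-1}. *)

Set Implicit Arguments.
Unset Strict Implicit.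
Unset Printing Implicit Defensive.

(** * Run starts and right-to-left minima of words *)

(* [p] plays the letter before [s]: for a whole word over [0, n) it is taken
   to be n, so that the first letter starts a run. *)
Fixpoint nstarts p (s : seq nat) : nat :=
  if s is x :: s' then (x < p) + nstarts x s' else 0.

Fixpoint rsorted p (s : seq nat) : bool :=
  if s is x :: s' then ((x < p) ==> all (ltn x) s') && rsorted x s' else true.

Fixpoint nrlmin (s : seq nat) : nat :=
  if s is x :: s' then all (ltn x) s' + nrlmin s' else 0.

Definition start_at p s i := nth 0 s i < last p (take i s).
Definition rlmin_at s i := all (ltn (nth 0 s i)) (drop i.+1 s).

Lemma nstartsE p s : nstarts p s = \sum_(0 <= i < size s) start_at p s i.
Proof.
elim: s p => [|x s IHs] p /=; first by rewrite big_geq.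
by rewrite big_nat_recl // IHs.
Qed.

Lemma nrlminE s : nrlmin s = \sum_(0 <= i < size s) rlmin_at s i.
Proof.
elim: s => [|x s IHs] /=; first by rewrite big_geq.
by rewrite big_nat_recl // IHs /rlmin_at /= drop0.
Qed.

Lemma rsortedP p s :
  reflect (forall i, i < size s -> start_at p s i -> rlmin_at s i)
          (rsorted p s).
Proof.
elim: s p => [|x s IHs] p /=; first by left.
apply: (iffP andP) => [[/implyP Hx /IHs Hs] [_ | i Hi Hst] | H].
- by rewrite /start_at /rlmin_at /= drop0.
- exact: Hs.
split; first by apply/implyP => Hx; have := H 0 isT Hx; rewrite /rlmin_at /= drop0.
by apply/IHs => i Hi Hst; apply: (H i.+1).
Qed.

Lemma nstarts_cat p a b : nstarts p (a ++ b) = nstarts p a + nstarts (last p a) b.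
Proof. by elim: a p => //= x a IHa p; rewrite IHa addnA. Qed.

(** Only the first letter is compared with the bound, so the bound may change together with the
    length of the word. *)
Lemma nstarts_bound p q s : all (gtn p) s -> all (gtn q) s -> nstarts p s = nstarts q s.
Proof. by case: s => //= x s /andP[-> _] /andP[-> _]. Qed.

Lemma rsorted_bound p q s : all (gtn p) s -> all (gtn q) s -> rsorted p s = rsorted q s.
Proof. by case: s => //= x s /andP[-> _] /andP[-> _]. Qed.

Section Monotone.
Variable f : nat -> nat.
Hypothesis f_mono : {mono f : x y / x < y}.

(** Applied with [f = bump y], the inverse of standardization after deleting [y]; the bound has to
    be mapped as well. *)
Lemma nstarts_map p s : nstarts (f p) (map f s) = nstarts p s.
Proof. by elim: s p => //= x s IHs p; rewrite f_mono IHs. Qed.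

Lemma all_ltn_map x s : all (ltn (f x)) (map f s) = all (ltn x) s.
Proof. by rewrite all_map; apply: eq_all => y /=; rewrite f_mono. Qed.

Lemma rsorted_map p s : rsorted (f p) (map f s) = rsorted p s.
Proof. by elim: s p => //= x s IHs p; rewrite f_mono IHs all_ltn_map. Qed.

Lemma nrlmin_map s : nrlmin (map f s) = nrlmin s.
Proof. by elim: s => //= x s ->; rewrite all_ltn_map. Qed.

End Monotone.

(** * Inserting a letter larger than all others *)

Section InsertMax.
Variable N : nat.

(** [N] starts no run because the letter before it is at most [N], and it lies above every letter of
    [a]. The only new condition is on the letter after [N], which now starts a run. *)
Lemma rsorted_insert_max p a b : last p a <= N -> all (gtn N) (a ++ b) ->
  rsorted p (a ++ N :: b) =
  rsorted p (a ++ b) && (if b is y :: b' then all (ltn y) b' else true).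
Proof.
elim: a p => [|x a IHa] p /=.
  move=> Hp; rewrite ltnNge Hp /=; case: b => //= y b /andP[yN _].
  by rewrite yN /=; case: all; rewrite ?implybT ?andbF ?andbT.
move=> Hl /andP[xN Hab]; rewrite IHa // andbA; congr (((_ ==> _) && _) && _).
by rewrite !all_cat /= xN.
Qed.

Lemma nrlmin_insert_max a b : all (gtn N) (a ++ b) ->
  nrlmin (a ++ N :: b) = nrlmin (a ++ b) + (b == [::]).
Proof.
elim: a => [|x a IHa] /=.
  by case: b => //= y b /andP[yN _]; rewrite ltnNge ltnW //= addn0.
by move=> /andP[xN Hab]; rewrite IHa // !all_cat /= xN addnA.
Qed.

Lemma nstarts_insert_max p a b : last p a <= N -> all (gtn N) b ->
  nstarts p (a ++ N :: b) =
  nstarts p (a ++ b) + (if b is y :: b' then last p a <= y else false).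
Proof.
move=> Hl; rewrite !nstarts_cat /= ltnNge Hl /=.
by case: b => [|y b] /= => [_|/andP[-> _]]; lia.
Qed.

End InsertMax.

(** * Inserting a right-to-left minimum that does not start a run *)

Section InsertRlmin.
Variables (y : nat) (b : seq nat).
Hypothesis yb : all (ltn y) b.

(** The first letter of [b] exceeds [y], hence also the last letter of [c], so it starts no run with
    or without [y] before it. *)
Lemma nstarts_insert_rlmin p c : last p c < y -> nstarts p (c ++ y :: b) = nstarts p (c ++ b).
Proof.
rewrite !nstarts_cat /= => Hl; congr (_ + _).
by case: b yb => [|z b'] /= => [_|/andP[yz _]]; lia.
Qed.

Lemma all_ltn_insert_rlmin x c : last x c < y -> all (ltn x) (c ++ y :: b) = all (ltn x) (c ++ b).
Proof.
move=> Hl; rewrite !all_cat /=; case Hc: (all (ltn x) c) => //=.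
suff -> : x < y by [].
(* If [x] lies below all of [c], it is at most the last letter, which is below [y]. *)
case/lastP: c Hl Hc => //= c z; rewrite last_rcons all_rcons /= => ? /andP[]; lia.
Qed.

Lemma nrlmin_insert_rlmin p c : last p c < y ->
  nrlmin (c ++ y :: b) = (nrlmin (c ++ b)).+1.
Proof.
elim: c p => [|x c IHc] p /= Hl; first by rewrite yb.
by rewrite (IHc x) // all_ltn_insert_rlmin // addnS.
Qed.

Lemma rsorted_insert_rlmin p c : last p c < y ->
  rsorted p (c ++ y :: b) = rsorted p (c ++ b).
Proof.
elim: c p => [|x c IHc] p /= Hl; last by rewrite IHc // all_ltn_insert_rlmin.
by rewrite yb implybT; case: b yb => //= z b' /andP[yz _]; lia.
Qed.

End InsertRlmin.

(** * Counting words that are permutations of 0, ..., n-1 *)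

Definition has_stats p k r s := [&& rsorted p s, nstarts p s == k & nrlmin s == r].

Definition rs_count n k r : nat :=
  \sum_(s <- permutations (iota 0 n)) has_stats n k r s.

Lemma perm_iota_size n t : t \in permutations (iota 0 n) -> size t = n.
Proof. by rewrite mem_permutations => /perm_size; rewrite size_iota. Qed.

Lemma perm_iota_bound n t : t \in permutations (iota 0 n) -> all (gtn n) t.
Proof.
rewrite mem_permutations => /perm_mem Ht; apply/allP => x.
by rewrite Ht mem_iota.
Qed.

Lemma perm_iota_uniq n t : t \in permutations (iota 0 n) -> uniq t.
Proof. by rewrite mem_permutations => /perm_uniq ->; rewrite iota_uniq. Qed.

Definition insert_at i x (t : seq nat) := take i t ++ x :: drop i t.

Lemma perm_insert_at i x t : perm_eq (insert_at i x t) (x :: t).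
Proof. by rewrite -[X in _ :: X](cat_take_drop i t) perm_catC /= perm_cons perm_catC. Qed.

(** The pair is recovered from the word: [t] by removing [n], and [i] as the index of [n]. *)
Lemma permutations_insert_max n :
  perm_eq (permutations (iota 0 n.+1))
    [seq insert_at i n t | t <- permutations (iota 0 n), i <- iota 0 n.+1].
Proof.
have iotaS : perm_eq (iota 0 n.+1) (n :: iota 0 n).
  by rewrite -addn1 iotaD /= add0n cats1 perm_rcons.
apply: uniq_perm; first exact: permutations_uniq.
- apply: allpairs_uniq; rewrite ?permutations_uniq ?iota_uniq //.
  move=> [t i] [t' i'] H H' Heq.
  case/allpairsP: H Heq => -[u j] [ut uj [-> ->]].
  case/allpairsP: H' => -[u' j'] [ut' uj' [-> ->]] {t i t' i'} /= Heq.
  have Hrem v l : v \in permutations (iota 0 n) -> l \in iota 0 n.+1 ->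
     (rem n (insert_at l n v) = v) * (index n (insert_at l n v) = l).
    move=> Hv Hl; have nv : n \notin take l v.
      apply/negP => /mem_take /(allP (perm_iota_bound Hv)) /=; by rewrite ltnn.
    have Hs : size (take l v) = l.
      apply: size_takel; rewrite (perm_iota_size Hv).
      by move: Hl; rewrite mem_iota; lia.
    split; last by rewrite /insert_at index_cat (negPf nv) /= eqxx addn0.
    rewrite /insert_at remE index_cat (negPf nv) /= eqxx addn0.
    rewrite Hs -[RHS](cat_take_drop l v) take_size_cat //.
    by rewrite -cat_rcons drop_size_cat // size_rcons Hs.
  have [uE jE] := Hrem _ _ ut uj; have [uE' jE'] := Hrem _ _ ut' uj'.
  move: uE jE uE' jE' => /= uE jE uE' jE'.
  by congr (_, _); [rewrite -uE -uE' Heq | rewrite -jE -jE' Heq].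
move=> s; rewrite mem_permutations; apply/idP/allpairsP.
- move=> Hs; have ns : n \in s by rewrite (perm_mem Hs) mem_iota /=; lia.
  exists (rem n s, index n s); split => /=.
  + rewrite mem_permutations -(perm_cons n).
    by rewrite -(permPr iotaS) -(permPr Hs) perm_sym perm_to_rem.
  + change (index n s \in iota 0 n.+1).
    by rewrite mem_iota -[X in 0 + X](size_iota 0 n.+1) -(perm_size Hs) index_mem.
  rewrite remE /insert_at.
  have Hsz : size (take (index n s) s) = index n s by rewrite size_takel // ltnW ?index_mem.
  rewrite take_size_cat // drop_size_cat //.
  by rewrite -{1}(cat_take_drop (index n s) s) (drop_nth 0) ?index_mem // nth_index.
- move=> [[u j] /= [Hu _ ->]].
  rewrite mem_permutations in Hu.
  by rewrite (permPl (perm_insert_at _ _ _)) (permPr iotaS) perm_cons.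
Qed.

(** In a run-sorted word, the places where inserting the largest letter splits a run and keeps the
    word run-sorted. *)
Definition marked p t i := ~~ start_at p t i && rlmin_at t i.

(** The cases are the end of the word, the front (where the largest letter starts a run without
    being a right-to-left minimum), the end of a run other than the last, and the inside of a run.
    The guards on [r] and [k] exclude the truncated predecessor of 0. *)
Lemma has_stats_insert_max n k r t i : t \in permutations (iota 0 n.+1) ->
  i <= n.+1 ->
  has_stats n.+2 k r (insert_at i n.+1 t) =
    if i == n.+1 then has_stats n.+1 k r.-1 t && (0 < r)
    else if i == 0 then false
    else if start_at n.+1 t i then has_stats n.+1 k r t
    else [&& has_stats n.+1 k.-1 r t, 0 < k & rlmin_at t i].
Proof.
move=> Ht Hi; have Hsz := perm_iota_size Ht; have Hb := perm_iota_bound Ht.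
have Hb2 : all (gtn n.+2) t by apply: sub_all Hb => x /=; lia.
have HbN : all (gtn n.+1) (take i t ++ drop i t) by rewrite cat_take_drop.
rewrite /has_stats /insert_at nrlmin_insert_max // cat_take_drop.
case: (posnP i) => [-> | i0].
  rewrite take0 drop0 /=; case: t Hsz Hb {Ht Hb2 HbN} => //= x t _ /andP[xn _].
  by rewrite ltnSn /= [n.+1 < x]ltnNge ltnW.
have Hl : last n.+2 (take i t) = last n.+1 (take i t).
  by case: t Hsz i0 {Ht Hb Hb2 HbN}; case: (i).
have Hl1 : last n.+1 (take i t) <= n.+1.
  have /= := mem_last n.+1 (take i t); rewrite inE => /predU1P[-> //|].
  by move=> /mem_take /(allP Hb) /=; lia.
rewrite rsorted_insert_max ?Hl // nstarts_insert_max ?Hl //; last first.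
  by move: HbN; rewrite all_cat => /andP[].
rewrite cat_take_drop (rsorted_bound Hb2 Hb) (nstarts_bound Hb2 Hb).
have [->|ni] := eqVneq i n.+1.
  have -> : drop n.+1 t = [::] by rewrite -Hsz drop_size.
  rewrite eqxx andbT addn0 addn1.
  by case: rsorted => //=; case: (_ == k) => //=; case: r => [|r]; rewrite ?andbT ?andbF.
have Hi' : i < size t by rewrite Hsz; lia.
rewrite (drop_nth 0 Hi') /= /rlmin_at /start_at addn0 [_ < last _ _]ltnNge.
rewrite -if_neg -ltnNge -/(start_at n.+1 t i).
case Hst: (start_at n.+1 t i); rewrite /start_at in Hst; rewrite leqNgt Hst /= ?addn0 ?addn1.
  by case Hrs: (rsorted _ t) => //=; move/rsortedP: Hrs => /(_ i Hi' Hst); rewrite /rlmin_at => ->.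
rewrite -!andbA; case: rsorted => //=; case: k => [|k] /=; first by rewrite !andbF.
by rewrite eqSS; case: all; rewrite ?andbF ?andbT.
Qed.

Lemma start_at0 n t : t \in permutations (iota 0 n.+1) -> start_at n.+1 t 0.
Proof.
move=> Ht; rewrite /start_at take0 /=.
by apply: (allP (perm_iota_bound Ht)); rewrite mem_nth // (perm_iota_size Ht).
Qed.

Lemma sum_has_stats_insert_max n k r t :
  t \in permutations (iota 0 n.+1) -> 0 < k -> 0 < r ->
  \sum_(0 <= i < n.+2) has_stats n.+2 k r (insert_at i n.+1 t) =
    has_stats n.+1 k r.-1 t + (k - 1) * has_stats n.+1 k r t
    + \sum_(0 <= i < n.+1) (has_stats n.+1 k.-1 r t && marked n.+1 t i).
Proof.
move=> Ht k0 r0; rewrite big_nat_recr //= has_stats_insert_max // eqxx r0 andbT.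
rewrite addnC -addnA; congr (_ + _).
(* The ends of the runs other than the last lie just before the [k - 1] run starts different from
   position 0. *)
have -> : (k - 1) * has_stats n.+1 k r t =
    \sum_(0 <= i < n.+1) (start_at n.+1 t i && (i != 0)) * has_stats n.+1 k r t.
  case Hst: has_stats; last by rewrite muln0 big1 // => i; rewrite muln0.
  have /and3P[_ /eqP <- _] := Hst.
  rewrite nstartsE (perm_iota_size Ht) !big_nat_recl //= start_at0 // addKn muln1.
  by apply: eq_bigr => i _; rewrite andbT muln1.
rewrite -big_split /=; apply: eq_big_nat => i /andP[_ Hi].
rewrite has_stats_insert_max //; last by lia.
rewrite (_ : (i == n.+1) = false) /marked; last by lia.
have [-> | i0] := eqVneq i 0; first by rewrite start_at0 //= !andbF.
by case: start_at; rewrite /= ?k0 ?andbF ?mul1n ?addn0.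
Qed.

Lemma sum_bool_count (T : Type) (P : pred T) (s : seq T) :
  \sum_(x <- s) (P x : nat) = count P s.
Proof. by elim: s => [|x s IHs]; rewrite ?big_nil ?big_cons //= IHs. Qed.

(** * Deleting and reinserting a marked letter *)

(* Puts [y] right after the last letter smaller than [y]. *)
Fixpoint insert_rlmin y (v : seq nat) : seq nat :=
  if all (ltn y) v then y :: v else
  if v is x :: v' then x :: insert_rlmin y v' else [::].

(** The default [y.+1] is never below [y], so an empty [c] is allowed by a separate disjunct. *)
Lemma insert_rlmin_cat y c b : all (ltn y) b -> (c == [::]) || (last y.+1 c < y) ->
  insert_rlmin y (c ++ b) = c ++ y :: b.
Proof.
move=> yb; elim: c => [|x c IHc] /=; first by case: b yb => //= z b ->.
move=> Hl; rewrite IHc; last by case: c Hl {IHc}.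
case: ifP => // /andP[yx]; rewrite all_cat => /andP[Hc _].
by case/lastP: c Hc Hl {IHc} => [|c z] /=; rewrite ?all_rcons ?last_rcons /=; lia.
Qed.

Lemma split_rlmin y v : y \notin v ->
  exists c b, [/\ v = c ++ b, all (ltn y) b & (c == [::]) || (last y.+1 c < y)].
Proof.
elim: v => [|x v IHv]; first by exists [::], [::].
rewrite inE negb_or => /andP[yx /IHv[[|z c] [b [-> yb Hl]]]].
  have [xy|xy] := ltnP x y; first by exists [:: x], b.
  by exists [::], (x :: b); rewrite /= yb andbT; split=> //; lia.
by exists (x :: z :: c), b.
Qed.

Lemma rem_insert_rlmin y v : y \notin v -> rem y (insert_rlmin y v) = v.
Proof.
elim: v => [|x v IHv] /=; first by rewrite eqxx.
rewrite inE negb_or => /andP[yx yv]; case: ifP => _ /=; first by rewrite eqxx.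
by rewrite eq_sym (negPf yx) IHv.
Qed.

Lemma bump_mono y : {mono bump y : a b / a < b}.
Proof. by move=> a b; rewrite /bump; lia. Qed.

Lemma perm_bump_iota y n : y <= n ->
  perm_eq (y :: map (bump y) (iota 0 n)) (iota 0 n.+1).
Proof.
move=> yn; apply: uniq_perm; rewrite ?iota_uniq //=.
  rewrite map_inj_uniq ?iota_uniq; last exact: can_inj (bumpK y).
  by rewrite andbT; apply/mapP => -[x _]; rewrite /bump; lia.
move=> x; rewrite -[X in _ = (_ \in X)]/(iota 0 n.+1) inE mem_iota.
have [-> | xy] := eqVneq x y; first by rewrite /=; lia.
apply/mapP/idP => [[z]|Hx]; first by rewrite mem_iota /bump; lia.
by exists (unbump y x); rewrite ?unbumpK // mem_iota /unbump; lia.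
Qed.

Lemma marked_insert_rlmin p c y b : y \notin c ->
  marked p (c ++ y :: b) (index y (c ++ y :: b)) = (last p c <= y) && all (ltn y) b.
Proof.
move=> yc; rewrite index_cat (negPf yc) /= eqxx addn0 /marked /start_at /rlmin_at.
rewrite nth_cat ltnn subnn /= take_size_cat // -cat_rcons drop_size_cat ?size_rcons //.
by rewrite -leqNgt.
Qed.

(** The map [f] is a bijection between the two counted sets; its inverse deletes [y] and applies
    [unbump y]. Since [0 < y], the letter 0 stays in the word and [f] puts [y] after it, so [y] is
    never first, where it would start a run. *)
Lemma sum_marked n j r y : 0 < y <= n -> 0 < r ->
  \sum_(t <- permutations (iota 0 n.+1))
     (has_stats n.+1 j r t && marked n.+1 t (index y t)) =
  rs_count n j r.-1.
Proof.
move=> /andP[y0 yn] r0; rewrite /rs_count !sum_bool_count -!size_filter.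
set f := fun u => insert_rlmin y (map (bump y) u).
have Hy u : y \notin map (bump y) u by apply/mapP => -[x _]; rewrite /bump; lia.
have inj_b : injective (bump y) := can_inj (bumpK y).
have Hf c b : c ++ b \in permutations (map (bump y) (iota 0 n)) ->
    all (ltn y) b -> (c == [::]) || (last y.+1 c < y) ->
    last n.+1 c < y.
  move=> Hcb yb; case: c Hcb => //= /[!mem_permutations] /perm_mem /(_ 0) H _.
  have : 0 \in b.
    by rewrite H; apply/mapP; exists 0; rewrite ?mem_iota /bump; lia.
  by move/(allP yb).
have stats c b : last n.+1 c < y -> all (ltn y) b -> forall u, c ++ b = map (bump y) u ->
    has_stats n.+1 j r (c ++ y :: b) = has_stats n j r.-1 u.
  move=> Hl yb u E; rewrite /has_stats rsorted_insert_rlmin // nstarts_insert_rlmin //.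
  rewrite (nrlmin_insert_rlmin yb Hl) E.
  (* The bound is shifted too, as [y <= n], so all statistics transfer along [bump y]. *)
  rewrite (_ : n.+1 = bump y n); last by rewrite /bump yn.
  rewrite rsorted_map ?nstarts_map ?nrlmin_map; try exact: bump_mono.
  by case: r r0 => // r' _; rewrite eqSS.
rewrite -[RHS](size_map f); apply/perm_size/uniq_perm.
- by rewrite filter_uniq // permutations_uniq.
- rewrite map_inj_uniq ?filter_uniq ?permutations_uniq // => u u' /(congr1 (rem y)).
  by rewrite !rem_insert_rlmin //; apply: inj_map.
move=> t; rewrite mem_filter; apply/andP/mapP.
  move=> [/andP[Hst Hm] Ht].
  have yt : y \in t by move: Ht; rewrite mem_permutations => /perm_mem ->; rewrite mem_iota; lia.
  have Ut := perm_iota_uniq Ht.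
  case/splitPr: t / yt Hst Hm Ht Ut => c b Hst Hm Ht.
  rewrite cat_uniq /= => /and4P[_ /norP[yc _] yb _].
  rewrite marked_insert_rlmin // in Hm; case/andP: Hm => Hl Hb.
  have ycb : y \notin c ++ b by rewrite mem_cat negb_or yc.
  have E : c ++ b = map (bump y) (map (unbump y) (c ++ b)).
    rewrite -map_comp map_id_in // => x Hx /=; rewrite unbumpK // inE.
    by apply: contraNneq ycb => <-.
  have Hu : map (unbump y) (c ++ b) \in permutations (iota 0 n).
    rewrite mem_permutations; apply: (perm_map_inj inj_b); rewrite -E.
    rewrite -(perm_cons y) (permPr (perm_bump_iota yn)).
    by move: Ht; rewrite mem_permutations => /permPr <-; rewrite perm_sym perm_catC /= perm_cons perm_catC.
  (* Being marked gives only the weak inequality; equality would put [y] in [c] or make it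
     [n.+1]. *)
  have Hl' : last n.+1 c < y.
    rewrite ltn_neqAle Hl andbT; apply: contraNneq yc => E'.
    have := mem_last n.+1 c; rewrite E' inE; case/predU1P => //; lia.
  exists (map (unbump y) (c ++ b)).
    by rewrite mem_filter Hu -(stats _ _ Hl' Hb _ E) Hst.
  rewrite /f -E insert_rlmin_cat //; case: (c) Hl' => //=; lia.
move=> [u]; rewrite mem_filter => /andP[Hst Hu] ->.
have [c [b [E yb Hl]]] := split_rlmin (Hy u).
have Hp : c ++ b \in permutations (map (bump y) (iota 0 n)).
  by rewrite -E mem_permutations perm_map // -mem_permutations.
have Hl' := Hf _ _ Hp yb Hl.
have yc : y \notin c by apply: contra (Hy u); rewrite E mem_cat => ->.
rewrite /f E insert_rlmin_cat // marked_insert_rlmin // ltnW // yb.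
rewrite (stats _ _ Hl' yb u) // Hst; split=> //.
rewrite mem_permutations -(permPr (perm_bump_iota yn)) perm_catC /= perm_cons perm_catC.
by rewrite -mem_permutations.
Qed.

(** * The recurrence for words *)

Lemma rs_count_rec n k r : 0 < k -> 0 < r ->
  rs_count n.+2 k r = rs_count n.+1 k r.-1 + (k - 1) * rs_count n.+1 k r
                      + n * rs_count n k.-1 r.-1.
Proof.
move=> k0 r0; rewrite {1}/rs_count (perm_big _ (permutations_insert_max n.+1)) big_allpairs_dep.
under eq_big_seq => t Ht.
  rewrite -[iota 0 n.+2]/(index_iota 0 n.+2) sum_has_stats_insert_max //.
  over.
rewrite !big_split /= -big_distrr /=; congr (_ + _).
(* Marked positions are re-indexed by the letters they carry, so that the sum over words can be
   taken for a fixed letter. *)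
rewrite (eq_big_seq (fun t => \sum_(y <- iota 0 n.+1)
    (has_stats n.+1 k.-1 r t && marked n.+1 t (index y t)))); last first.
  move=> t Ht; rewrite -[_ :: _]/(iota 0 n.+1) in Ht.
  have := Ht; rewrite mem_permutations => Hp.
  rewrite -[RHS](perm_big _ Hp) [RHS](big_nth 0) (perm_iota_size Ht) /=.
  apply: eq_big_nat => i Hi; rewrite index_uniq ?(perm_iota_uniq Ht) //.
  by rewrite (perm_iota_size Ht).
(* The letter 0 is never marked: it starts a run, since a 0 just before it would occur before its
   own first index. *)
rewrite exchange_big /= big_cons big1_seq ?add0n; last first.
  move=> t /andP[_ Ht]; rewrite /marked /start_at nth_index; last first.
    by move: Ht; rewrite mem_permutations => /perm_mem ->.
  rewrite lt0n; set l := last _ _; have [l0|] := eqVneq l 0; last by rewrite /= andbF.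
  have := mem_last n.+1 (take (index 0 t) t); rewrite -/l l0 inE /= => /(index_ltn).
  by rewrite ltnn.
rewrite (eq_big_seq (fun _ => rs_count n k.-1 r.-1)); last first.
  by move=> y; rewrite mem_iota => Hy; apply: sum_marked => //; lia.
by rewrite big_const_seq count_predT size_iota iter_addn_0 mulnC.
Qed.

(** * Permutations and their words *)

Section Word.
Variable n : nat.
Implicit Type s : 'S_n.

Definition word s : seq nat := map val (one_line s).

Lemma size_word s : size (word s) = n.
Proof. by rewrite size_map /one_line size_map size_enum_ord. Qed.

Lemma nth_word s (i : 'I_n) : nth 0 (word s) i = s i.
Proof.
rewrite /word /one_line -map_comp (nth_map i) ?size_enum_ord //=.
by rewrite nth_ord_enum.
Qed.

Lemma word_uniq s : uniq (word s).
Proof.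
rewrite map_inj_uniq; last exact: val_inj.
by rewrite map_inj_uniq ?enum_uniq //; apply: perm_inj.
Qed.

Lemma word_bound s : all (gtn n) (word s).
Proof. by apply/allP => _ /mapP[i _ ->] /=. Qed.

Lemma word_inj : injective word.
Proof.
move=> s t E; apply/permP => i; apply: val_inj.
by rewrite /= -!nth_word E.
Qed.

Lemma word_mem s : word s \in permutations (iota 0 n).
Proof.
rewrite mem_permutations; apply: uniq_perm; rewrite ?iota_uniq ?word_uniq //.
have [] // := @uniq_min_size _ (word s) (iota 0 n) (word_uniq s).
  by move=> x /(allP (word_bound s)); rewrite mem_iota.
by rewrite size_word size_iota.
Qed.

(** Words of permutations are distinct members of the right-hand list, and both lists have n!
    elements. *)
Lemma perm_words : perm_eq [seq word s | s <- enum 'S_n] (permutations (iota 0 n)).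
Proof.
have U : uniq [seq word s | s <- enum 'S_n].
  by rewrite map_inj_uniq ?enum_uniq //; apply: word_inj.
apply: uniq_perm => //; first exact: permutations_uniq.
have [] // := @uniq_min_size _ _ (permutations (iota 0 n)) U.
  by move=> _ /mapP[s _ ->]; apply: word_mem.
rewrite size_map -cardE size_permutations ?iota_uniq // size_iota.
by rewrite -card_Sn; apply/subset_leq_card/subsetP.
Qed.

Lemma is_rlminE s (i : 'I_n) : is_rlmin s i = rlmin_at (word s) i.
Proof.
apply/forallP/(all_nthP 0) => [H j | H j].
  rewrite size_drop size_word => Hj; rewrite nth_drop nth_word.
  have Hij : i.+1 + j < n by lia.
  have := H (Ordinal Hij); rewrite -(nth_word s (Ordinal Hij)) /= => /implyP; apply; lia.
apply/implyP => ij; have := H (j - i.+1); rewrite size_drop size_word.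
rewrite nth_drop subnKC // !nth_word; apply.
have := ltn_ord j; lia.
Qed.

Lemma num_rlminE s : num_rlmin s = nrlmin (word s).
Proof.
rewrite nrlminE size_word big_mkord /num_rlmin -sum1_card big_mkcond.
by apply: eq_bigr => i _; rewrite inE -is_rlminE; case: (is_rlmin s i).
Qed.

(** The quantifier ranges over the one predecessor of [i]. It is vacuous at position 0, which starts
    a run because every letter is below the bound [n]. *)
Lemma start_at_word s (i : 'I_n) :
  start_at n (word s) i = [forall j : 'I_n, (j.+1 == i) ==> (s i < s j)].
Proof.
rewrite /start_at nth_word; case Ei: (val i) (ltn_ord i) => [|j] Hj /=.
  by rewrite take0 /= ltn_ord; symmetry; apply/forallP => k.
rewrite (take_nth 0) ?size_word ?(ltnW Hj) // last_rcons.
have jE := nth_word s (Ordinal (ltnW Hj)); rewrite /= in jE; rewrite jE.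
apply/idP/forallP => [H k|/(_ (Ordinal (ltnW Hj)))].
  by apply/implyP => /eqP [Ek]; rewrite (_ : k = Ordinal (ltnW Hj)) //; apply: val_inj.
by move=> /implyP; apply.
Qed.

(** Otherwise the factor could be extended to the left by one position, against maximality. *)
Lemma is_run_start s f : is_run s f -> start_at n (word s) f.1.
Proof.
case: f => i j /andP[/andP[/= ij /forallP inc] /forallP max].
rewrite start_at_word; apply/forallP => k; apply/implyP => /eqP Ek.
rewrite ltnNge; apply/negP => Hki.
have {}Hki : s k < s i.
  rewrite ltn_neqAle Hki andbT; apply/eqP => /val_inj /perm_inj Ekk.
  by move: Ek; rewrite Ekk; lia.
have := max (k, j); rewrite /increasing_factor /=.
have -> /= : k <= j by lia.
have -> /= : k <= i by lia.
rewrite leqnn andbT => /implyP Hm.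
suff /Hm /eqP[E] : [forall p : 'I_n, forall q : 'I_n,
    [&& k <= p, p < q & q <= j] ==> (s p < s q)].
  by move: Ek; rewrite E; lia.
apply/forallP => p; apply/forallP => q; apply/implyP => /and3P[kp pq qj].
have Hinc (p' q' : 'I_n) : i <= p' -> p' < q' -> q' <= j -> s p' < s q'.
  by move=> *; have /forallP/(_ q')/implyP := inc p'; apply; apply/and3P.
have [ip|pi] := leqP i p; first exact: Hinc.
have -> : p = k by apply: val_inj => /=; lia.
have [qi|qi] := eqVneq q i; first by rewrite qi.
apply: ltn_trans Hki _; apply: Hinc => //.
have : val q != val i by apply: contra qi => /eqP/val_inj ->.
by rewrite /=; lia.
Qed.

(** The longest increasing factor with left end [i] is a run: the descent before [i] prevents any
    extension to the left. *)
Lemma start_is_run s (i : 'I_n) : start_at n (word s) i -> exists j, is_run s (i, j).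
Proof.
rewrite start_at_word => /forallP Hst.
have inc0 : increasing_factor s (i, i).
  rewrite /increasing_factor leqnn /=; apply/forallP => p; apply/forallP => q.
  by apply/implyP; lia.
case: (@arg_maxnP _ i (fun j => increasing_factor s (i, j)) val inc0) => j Hj max.
exists j; rewrite /is_run Hj /=; apply/forallP => -[k l]; apply/implyP => /= /and3P[Hkl ki jl].
have Ek : k = i.
  apply: val_inj; apply/eqP; rewrite eqn_leq ki leqNgt; apply/negP => /= ki'.
  have i0 : 0 < i by exact: leq_ltn_trans ki'.
  have Hp : i.-1 < n by have := ltn_ord i; lia.
  have := Hst (Ordinal Hp); rewrite /= prednK // eqxx /=.
  case/andP: Hkl => /= kl /forallP/(_ (Ordinal Hp))/forallP/(_ i)/implyP /=.
  have ij : i <= j by case/andP: Hj.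
  by move=> H; rewrite ltnNge ltnW // H //; lia.
rewrite Ek in Hkl *; have lj : l <= j := max l Hkl.
by apply/eqP; congr (_, _); apply: val_inj; apply/eqP; rewrite eqn_leq /= jl lj.
Qed.

Lemma is_run_inj s : {in [set f | is_run s f] &, injective fst}.
Proof.
move=> [i j] [i' j'] /[!inE] /andP[H /forallP max] /andP[H' /forallP max'] /= Ei.
rewrite -{}Ei in H' max' *.
have [jj|jj] := leqP j j'.
  have := max (i, j'); rewrite H' /= leqnn jj => /eqP //.
by have := max' (i, j); rewrite H /= leqnn ltnW // => /eqP.
Qed.

(** Taking the left end is a bijection from runs to run starts. *)
Lemma num_runsE s : num_runs s = nstarts n (word s).
Proof.
rewrite nstartsE size_word big_mkord /num_runs -(card_in_imset (@is_run_inj s)).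
rewrite -sum1_card big_mkcond /=.
apply: eq_bigr => i _; congr (nat_of_bool _).
apply/imsetP/idP => [[f]|/start_is_run[j Hj]].
  by rewrite inE => /is_run_start ? ->.
by exists (i, j); rewrite ?inE.
Qed.

End Word.

(** * Set partitions and lists of increasing blocks *)

Definition block_list (L : seq (seq nat)) : bool :=
  all (fun b => (b != [::]) && sorted ltn b) L && sorted ltn (map (head 0) L).

Lemma rsorted_increasing_cat x b s : path ltn x b -> rsorted x (b ++ s) = rsorted (last x b) s.
Proof.
elim: b x => //= y b IHb x /andP[xy yb]; rewrite IHb //.
by rewrite [y < x]ltnNge ltnW.
Qed.

Lemma all_ltn_flatten x L :
  all (fun b => (b != [::]) && sorted ltn b) L -> all (ltn x) (map (head 0) L) ->
  all (ltn x) (flatten L).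
Proof.
elim: L => //= -[|y b] L IHL //= /andP[yb HL] /andP[xy HxL].
rewrite xy all_cat IHL // andbT; apply: sub_all (order_path_min ltn_trans yb).
by move=> z; apply: ltn_trans.
Qed.

(** Blocks need not be runs, but only the head of a block can start a run, and each head is below
    all later letters because the blocks and the list of heads increase. *)
Lemma rsorted_flatten p L : block_list L -> rsorted p (flatten L).
Proof.
rewrite /block_list; elim: L p => //= -[|x b] L IHL p //= /andP[/andP[xb HL] xL].
rewrite rsorted_increasing_cat // IHL ?HL ?(path_sorted xL) // andbT.
rewrite all_cat (order_path_min ltn_trans xb) all_ltn_flatten ?implybT //.
exact: order_path_min ltn_trans xL.
Qed.

Lemma subseq_head_flatten (L : seq (seq nat)) :
  all (fun b => b != [::]) L -> subseq (map (head 0) L) (flatten L).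
Proof.
elim: L => //= -[|x b] L IHL //= HL; rewrite eqxx.
exact: subseq_trans (IHL HL) (suffix_subseq _ _).
Qed.

(** The word is cut before each run start. The list [b] is the rest of the run containing [p], kept
    apart so that the induction can prepend a letter to it. *)
Lemma rsorted_blocks p s : uniq (p :: s) -> rsorted p s ->
  exists b L, [/\ s = b ++ flatten L, path ltn p b & block_list L].
Proof.
elim: s p => [|y s IHs] p; first by exists [::], [::].
rewrite [uniq _]/= inE negb_or => /andP[/andP[py _] Us] /= /andP[Hy Hs].
have [b [L [Es yb HL]]] := IHs y Us Hs.
have [yp|pl] := ltnP y p; last first.
  exists (y :: b), L; rewrite Es /=; split=> //; lia.
exists [::], ((y :: b) :: L); rewrite Es /=; split=> //.
move: HL; rewrite /block_list /= yb => /andP[HL hL]; rewrite HL /=.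
rewrite path_min_sorted //; move: Hy; rewrite yp Es all_cat => /andP[_].
move=> /allP Hy; apply/allP => z zL; apply: Hy.
apply: mem_subseq zL; apply: subseq_head_flatten.
by apply: sub_all HL => c /andP[].
Qed.

Section Blocks.
Variable n : nat.
Implicit Types (B : {set 'I_n}) (l : seq nat) (P : {set {set 'I_n}}).

Lemma sorted_block B : sorted ltn (map val (enum B)).
Proof.
apply: (subseq_sorted ltn_trans) (iota_ltn_sorted 0 n).
by rewrite -val_enum_ord; apply: map_subseq; rewrite enumT; apply: filter_subseq.
Qed.

Lemma block_minE B : B != set0 -> block_min B = head 0 (map val (enum B)).
Proof.
move=> B0; rewrite /block_min -big_filter [index_enum _]unlock -[filter _ _]/(enum B).
rewrite -(big_map val xpredT id).
have : map val (enum B) != [::].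
  by rewrite -size_eq0 size_map -cardE cards_eq0.
have : all (gtn n) (map val (enum B)) by apply/allP => _ /mapP[i _ ->] /=.
case: map (sorted_block B) => // x l /= xl /andP[xn _] _.
rewrite big_cons; apply/minn_idPl.
have := order_path_min ltn_trans xl; elim: l {xl} => [|y l IHl] /=.
  by rewrite big_nil ltnW.
by move=> /andP[xy /IHl]; rewrite big_cons leq_min (ltnW xy).
Qed.

Definition block_set l : {set 'I_n} := [set i | val i \in l].

Lemma block_setK l : sorted ltn l -> all (gtn n) l -> map val (enum (block_set l)) = l.
Proof.
move=> Hl /allP ln; apply: (irr_sorted_eq ltn_trans ltnn) => // [|x].
  exact: sorted_block.
apply/mapP/idP => [[i]|xl]; first by rewrite mem_enum inE => ? ->.
by exists (Ordinal (ln x xl)); rewrite // mem_enum inE.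
Qed.

Lemma run_sorted_word (s : 'S_n) : run_sorted s = rsorted n (word s).
Proof.
apply/existsP/idP => [[P /andP[partP /eqP sE]]|rs].
  have nzP B : B \in P -> B != set0.
    by case/and3P: partP => _ _ P0 BP; apply: contraNneq P0 => <-.
  pose srt := sort (fun B C : {set 'I_n} => block_min B <= block_min C) (enum P).
  have wE : word s = flatten [seq map val (enum B) | B <- srt].
    by rewrite /word sE map_flatten /block_representation -map_comp.
  have srtP B : B \in srt -> B \in P by rewrite mem_sort mem_enum.
  have ne : all (fun b => (b != [::]) && sorted ltn b) [seq map val (enum B) | B <- srt].
    apply/allP => _ /mapP[B /srtP /nzP B0 ->]; rewrite sorted_block andbT.
    by rewrite -size_eq0 size_map -cardE cards_eq0.
  rewrite wE; apply: rsorted_flatten; rewrite /block_list ne ltn_sorted_uniq_leq /=.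
  apply/andP; split.
    (* The minima are distinct letters of the word, so sorting by the weak order on minima gives a
       strictly increasing list. *)
    apply: subseq_uniq (word_uniq s); rewrite wE; apply: subseq_head_flatten.
    by apply: sub_all ne => c /andP[].
  rewrite -map_comp (@eq_in_map _ _ _ (@block_min n) srt).1; last first.
    by move=> B /srtP /nzP /block_minE ->.
  rewrite sorted_map; apply: sort_sorted => B C; exact: leq_total.
have Un : uniq (n :: word s).
  rewrite /= word_uniq andbT; apply/negP => /(allP (word_bound s)) /=.
  by rewrite ltnn.
have [b [L [wE nb HL]]] := rsorted_blocks Un rs.
(* No letter can continue a run from [n], since all letters are below [n]. *)
have {nb} b0 : b = [::].
  case: b nb wE => //= x b /andP[nx _] wE.
  by have := word_bound s; rewrite wE /=; lia.
rewrite {b}b0 /= in wE.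
have [/allP ne hL] := andP HL.
have Lb l : l \in L -> all (gtn n) l.
  move=> lL; apply/allP => x xl; apply: (allP (word_bound s)).
  by rewrite wE; apply/flattenP; exists l.
have LK l : l \in L -> map val (enum (block_set l)) = l.
  by move=> lL; apply: block_setK (Lb _ lL); case/andP: (ne _ lL).
have L0 l : l \in L -> block_set l != set0.
  move=> lL; rewrite -cards_eq0 cardE -(size_map val) LK // size_eq0.
  by case/andP: (ne _ lL).
have Lmin : map (@block_min n) (map block_set L) = map (head 0) L.
  rewrite -map_comp; apply/eq_in_map => l lL /=; rewrite block_minE ?L0 //.
  by rewrite LK.
have Uhead : uniq (map (head 0) L) by move: hL; rewrite ltn_sorted_uniq_leq => /andP[].
have UL : uniq (map block_set L) by apply: (map_uniq (f := @block_min n)); rewrite Lmin.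
pose P := [set B in map block_set L].
have permP : perm_eq (enum P) (map block_set L).
  by apply: uniq_perm; rewrite ?enum_uniq // => B; rewrite mem_enum inE.
have covP : cover P = [set: 'I_n].
  apply/setP => i; rewrite inE; apply/bigcupP.
  have /flattenP[l lL il] : val i \in flatten L.
    rewrite -wE; have := word_mem s; rewrite mem_permutations => /perm_mem ->.
    by rewrite mem_iota /=.
  by exists (block_set l); rewrite inE //; apply: map_f.
exists P; apply/andP; split.
  apply/and3P; split; first by rewrite covP.
  (* Disjointness follows by counting: the block sizes add up to the length [n] of the word. *)
  - rewrite /trivIset covP cardsT card_ord -big_enum (perm_big _ permP) big_map.
    have szL : \sum_(l <- L) size l = n.
      by have := size_word s; rewrite wE size_flatten sumnE big_map.
    apply/eqP; rewrite -[RHS]szL.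
    by apply: eq_big_seq => l lL; rewrite cardE -(size_map val) LK.
  - by rewrite inE; apply/mapP => -[l /L0 l0 E]; rewrite -E eqxx in l0.
apply/eqP/(inj_map val_inj); rewrite -/(word s) wE map_flatten /block_representation.
rewrite (_ : sort _ _ = map block_set L).
  rewrite -!map_comp; congr flatten; rewrite -[LHS]map_id.
  by apply/eq_in_map => l lL /=; rewrite LK.
(* Both lists have the same members and strictly increasing block minima, so they coincide. *)
apply: (@irr_sorted_eq _ (relpre (@block_min n) ltn)) => [B C D|B|||B].
- exact: ltn_trans.
- exact: ltnn.
- rewrite -sorted_map ltn_sorted_uniq_leq; apply/andP; split.
    by rewrite (perm_uniq (perm_map _ (_ : perm_eq _ (map block_set L)))) ?Lmin ?perm_sort.
  by rewrite sorted_map; apply: sort_sorted => B C; apply: leq_total.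
- by rewrite -sorted_map Lmin.
- by rewrite mem_sort (perm_mem permP).
Qed.

End Blocks.

(** * Transfer of the recurrence to permutations *)

Lemma run_sorted_countE n k r : run_sorted_count n k r = rs_count n k r.
Proof.
rewrite /rs_count -(perm_big _ (perm_words n)) big_map big_enum /=.
rewrite /run_sorted_count -sum1_card big_mkcond /=; apply: eq_bigr => s _.
by rewrite inE run_sorted_word num_runsE num_rlminE -/(has_stats n k r _); case: has_stats.
Qed.

Theorem theorem29 :
  [/\ run_sorted_count 0 0 0 = 1,
      run_sorted_count 1 1 1 = 1 &
      forall n k r : nat, 2 <= n -> 1 <= k -> 1 <= r ->
        run_sorted_count n k r =
          run_sorted_count (n - 1) k (r - 1)
          + (k - 1) * run_sorted_count (n - 1) k r
          + (n - 2) * run_sorted_count (n - 2) (k - 1) (r - 1)].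
Proof.
split; [by rewrite run_sorted_countE /rs_count big_seq1..|].
move=> [|[|n]] // k r _ k0 r0; rewrite !run_sorted_countE rs_count_rec //.
by rewrite subSS subn0 !subn1 subn2.
Qed.
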